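(* Fix $n$, $T$, $A$, $\vec f$, $\vec u(0)$ and $\alpha$ as in the context, so that in particular, for all $t\in[0,T]$, $a_{ii}(t)>\sum_{j\ne i}|a_{ij}(t)|$ for $1\le i\le n$, $a_{ij}(t)\le 0$ for $i\neq j$, and $0<\alpha<\min_{t\in[0,T],\,1\le i\le n}\sum_{j=1}^n a_{ij}(t)$. Let $\vec w$ be the singular component of the solution $\vec u$. Then there exists a constant $C$, independent of $t$ and of $\varepsilon_1,\dots,\varepsilon_n$, such that for each $t\in[0,T]$ and each $i=1,\dots,n$, $$|w_i(t)|\le C B_n(t),\qquad |w_i'(t)|\le C\sum_{q=i}^n\frac{B_q(t)}{\varepsilon_q},\qquad |\varepsilon_i w_i''(t)|\le C\sum_{q=1}^n\frac{B_q(t)}{\varepsilon_q}.$$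
   Context: Problem: $n\ge 1$ is an integer, $T>0$, $A(t)=(a_{ij}(t))$ is an $n\times n$ matrix-valued function and $\vec f$ an $n$-vector-valued function on $[0,T]$, both continuously differentiable. $E=\mathrm{diag}(\varepsilon_1,\dots,\varepsilon_n)$, where the parameters satisfy $0<\varepsilon_1<\dots<\varepsilon_n\le 1$ and $T\ge 2\max_i(\varepsilon_i)/\alpha$. The operator is $\vec L\vec y=E\vec y'+A\vec y$, and $\vec u$ is the solution of $\vec L\vec u=\vec f$ on $(0,T]$ with given initial value $\vec u(0)$. Decomposition: $\vec u=\vec v+\vec w$, where the smooth component $\vec v$ solves $\vec L\vec v=\vec f$ on $(0,T]$ with $\vec v(0)=A^{-1}(0)\vec f(0)$, and the singular component $\vec w$ solves $\vec L\vec w=\vec 0$ on $(0,T]$ with $\vec w(0)=\vec u(0)-\vec v(0)$. Layer functions: $B_i(t)=e^{-\alpha t/\varepsilon_i}$, $1\le i\le n$. The constant $C$ may depend on $n,T,A,\vec f,\vec u(0),\alpha$, but not on $t$ or $\varepsilon_1,\dots,\varepsilon_n$. *)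

(* Defs.v *)
From HB Require Import structures.
From mathcomp Require Import all_boot all_order all_algebra.
From mathcomp Require Import all_classical all_reals all_analysis.
Import Order.TTheory GRing.Theory Num.Theory.
Import numFieldNormedType.Exports.

Set Implicit Arguments.
Unset Strict Implicit.
Unset Printing Implicit Defensive.

Local Open Scope classical_set_scope.
Local Open Scope ring_scope.

(* The derivative relative to [D]: the difference quotient is only taken along
   points of [D], so for [D = `[0, T]] this is the ordinary derivative at
   interior points and the one-sided derivative at [0] and [T].  Values of [f]
   outside [D] play no role when [x \in D]. *)
Definition is_derivative_in (R : realType) (V : normedModType R)
    (D : set R) (f : R -> V) (x : R) (l : V) : Prop :=
  (fun y => (y - x)^-1 *: (f y - f x)) @ within D x^' --> l.

Definition C1_on (R : realType) (V : normedModType R)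
    (T : R) (f : R -> V) : Prop :=
  exists f1 : R -> V,
    (forall t, 0 <= t <= T -> is_derivative_in `[0, T] f t (f1 t)) /\
    {within `[0, T], continuous f1}.

(* [y] solves [E y' + A y = g] on (0, T] with [y 0 = y0], where
   [E = diag(eps_1, ..., eps_n)].  Continuity on the closed interval ties the
   initial value to the equation, which is not imposed at [t = 0]. *)
Definition solves_ivp (R : realType) (n : nat) (T : R)
    (eps : 'rV[R]_n.+1) (A : R -> 'M[R]_n.+1) (g : R -> 'cV[R]_n.+1)
    (y0 : 'cV[R]_n.+1) (y : R -> 'cV[R]_n.+1) : Prop :=
  [/\ {within `[0, T], continuous y},
      y 0 = y0 &
      forall t, 0 < t <= T ->
        exists2 y1 : 'cV[R]_n.+1,
          is_derivative_in `[0, T] y t y1 &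
          diag_mx eps *m y1 + A t *m y t = g t].

(* [w] is the singular component of [u]; [v] is the smooth component. *)
Definition singular_component (R : realType) (n : nat) (T : R)
    (eps : 'rV[R]_n.+1) (A : R -> 'M[R]_n.+1) (f : R -> 'cV[R]_n.+1)
    (u w : R -> 'cV[R]_n.+1) : Prop :=
  exists2 v : R -> 'cV[R]_n.+1,
    solves_ivp T eps A f (invmx (A 0) *m f 0) v &
    solves_ivp T eps A (fun=> 0) (u 0 - v 0) w.

Definition layer (R : realType) (n : nat) (alpha : R) (eps : 'rV[R]_n.+1)
    (i : 'I_n.+1) (t : R) : R :=
  expR (- (alpha * t / eps 0 i)).

(* Main.v *)
Require Import Defs.
From HB Require Import structures.
From mathcomp Require Import all_boot all_order all_algebra.
From mathcomp Require Import all_classical all_reals all_analysis.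
From mathcomp Require Import lra ring.
Import Order.TTheory GRing.Theory Num.Theory.
Import numFieldNormedType.Exports.

Local Open Scope classical_set_scope.
Local Open Scope ring_scope.

(* Every bound is a comparison [|z_i| <= psi_i] obtained from the maximum
   principle for [E y' + A y], where [psi] is a combination of the layer
   functions.  For [w] one takes [psi = C B_n (1, ..., 1)].  The derivative
   [z = w'] solves [E z' + A z = - A' w] with [z_i(0) = O(1 / eps_i)], and

     psi_i = \sum_(q >= i) c_q B_q / eps_q - (d_i / eps_i) \sum_(q < i) B_q

   with [c_q] growing geometrically and [d_i] proportional to [c_(i-1)] is a
   supersolution.  The equation for [z] then gives the bound on [w'']. *)

(** * Calculus of derivatives relative to a set *)

Section relative_derivative.
Context {R : realType}.
Implicit Types (D : set R) (f g : R -> R) (t l : R).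

Lemma is_derivative_in_entry D m p (F : R -> 'M[R]_(m.+1, p.+1)) t
    (L : 'M[R]_(m.+1, p.+1)) i j :
  is_derivative_in D F t L ->
  is_derivative_in D (fun x => F x i j : R^o) t (L i j).
Proof.
move=> dF.
have := cvg_comp _ _ dF (@coord_continuous R _ _ i j L).
by apply: cvg_trans; apply: near_eq_cvg; near=> y; rewrite /= !mxE.
Unshelve. all: by end_near. Qed.

Lemma is_derivative_in_mx D m p (F : R -> 'M[R]_(m.+1, p.+1)) t
    (L : 'M[R]_(m.+1, p.+1)) :
  (forall i j, is_derivative_in D (fun x => F x i j : R^o) t (L i j)) ->
  is_derivative_in D F t L.
Proof.
move=> dF; apply/cvg_mx_entourageP => E entE.
have H i j : \forall y \near within D t^',
    (L i j, ((y - t)^-1 *: (F y - F t)) i j) \in E.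
  have /cvg_entourageP/(_ _ entE) := dF i j.
  rewrite near_map => dE; near=> y.
  apply/mem_set; rewrite !mxE; near: y.
  exact: dE.
have := filter_forall _ (fun i => filter_forall _ (H i)).
exact.
Unshelve. all: by end_near. Qed.

(** Away from [t], [f y] is [f t] plus [y - t] times the difference quotient, and that product tends
    to [0 *: l]. *)
Lemma is_derivative_in_cvg (V : normedModType R) D (f : R -> V) t (l : V) :
  is_derivative_in D f t l -> f @ within D t^' --> f t.
Proof.
move=> df.
have yt : (fun y : R => y - t) @ within D t^' --> t - t.
  apply: cvgB; last exact: cvg_cst.
  by apply: (cvg_trans (cvg_within _)); exact: cvg_within.
have H : (fun y : R => (y - t) *: ((y - t)^-1 *: (f y - f t)) + f t)
    @ within D t^' --> f t.
  rewrite -[in X in _ --> X](add0r (f t)) -(scale0r l) -(subrr t).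
  by apply: cvgD; [exact: cvgZ|exact: cvg_cst].
apply: cvg_trans H; apply: near_eq_cvg.
rewrite near_withinE /dnbhs near_withinE; near=> y => yt0 Dy.
by rewrite scalerA mulfV ?scale1r ?subrK// subr_eq0.
Unshelve. all: by end_near. Qed.

Lemma is_derivative_in_continuous (V : normedModType R) D (f : R -> V) :
  (forall t, D t -> exists l : V, is_derivative_in D f t l) ->
  {within D, continuous f}.
Proof.
move=> df; apply/subspace_continuousP => t Dt.
have [l /is_derivative_in_cvg ft] := df t Dt.
move=> U fU.
have fty : \forall y \near t, y != t -> D y -> U (f y) := ft U fU.
suff : \forall y \near t, D y -> U (f y) by [].
apply: filterS fty => y fy Dy.
by have [->|/fy] := eqVneq y t; [exact: nbhs_singleton|exact].
Qed.

Lemma is_derivative_in_cst D (c : R) t :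
  is_derivative_in D (fun=> c : R^o) t (0 : R^o).
Proof.
have H : (fun=> 0 : R^o) @ within D t^' --> (0 : R^o) by exact: cvg_cst.
apply: cvg_trans H; apply: near_eq_cvg; near=> y.
by rewrite subrr scaler0.
Unshelve. all: by end_near. Qed.

Lemma is_derivative_inD D f g t l l' :
  is_derivative_in D (f : R -> R^o) t l ->
  is_derivative_in D (g : R -> R^o) t l' ->
  is_derivative_in D (fun x => f x + g x : R^o) t (l + l' : R^o).
Proof.
move=> df dg.
have H : (fun y : R => (y - t)^-1 * (f y - f t) + (y - t)^-1 * (g y - g t))
    @ within D t^' --> l + l' by exact: cvgD df dg.
apply: cvg_trans H; apply: near_eq_cvg; near=> y.
by rewrite -[RHS]/(_ * _) -mulrDr opprD addrACA.
Unshelve. all: by end_near. Qed.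

Lemma is_derivative_inM D f g t l l' :
  is_derivative_in D (f : R -> R^o) t l ->
  is_derivative_in D (g : R -> R^o) t l' ->
  is_derivative_in D (fun x => f x * g x : R^o) t (l * g t + f t * l' : R^o).
Proof.
move=> df dg.
have H : (fun y : R => (y - t)^-1 * (f y - f t) * g y +
    f t * ((y - t)^-1 * (g y - g t))) @ within D t^' --> l * g t + f t * l'.
  apply: cvgD; apply: cvgM.
  - exact: df.
  - exact: is_derivative_in_cvg dg.
  - exact: cvg_cst.
  - exact: dg.
apply: cvg_trans H; apply: near_eq_cvg; near=> y.
rewrite -[RHS]/(_ * _); ring.
Unshelve. all: by end_near. Qed.

Lemma is_derivative_inZ D c f t l :
  is_derivative_in D (f : R -> R^o) t l ->
  is_derivative_in D (fun x => c * f x : R^o) t (c * l : R^o).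
Proof.
move=> df; have := is_derivative_inM D _ _ _ _ _ (is_derivative_in_cst D c t) df.
by rewrite mul0r add0r.
Qed.

Lemma is_derivative_in_sum D (I : Type) (r : seq I) (f : I -> R -> R)
    t (l : I -> R) :
  (forall i, is_derivative_in D (f i : R -> R^o) t (l i)) ->
  is_derivative_in D (fun x => \sum_(i <- r) f i x : R^o) t
    (\sum_(i <- r) l i : R^o).
Proof.
move=> df; elim: r => [|i r IH].
  rewrite big_nil.
  have -> : (fun x : R => \sum_(i <- [::]) f i x) = (fun=> 0).
    by apply/funext => x; rewrite big_nil.
  exact: is_derivative_in_cst.
rewrite big_cons.
have -> : (fun x : R => \sum_(j <- i :: r) f j x)
    = (fun x => f i x + \sum_(j <- r) f j x).
  by apply/funext => x; rewrite big_cons.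
exact: is_derivative_inD.
Qed.

Lemma is_derive_is_derivative_in D f t l :
  is_derive t 1 f l -> is_derivative_in D (f : R -> R^o) t (l : R^o).
Proof.
move=> df; apply/cvgrPdist_le => e e0.
have H : h^-1 *: ((f (h *: 1 + t) : R^o) - f t) @[h --> (0 : R)^'] --> (l : R^o).
  by have [exd <-] := df; exact: exd.
have /cvgrPdist_le/(_ e e0) := H.
rewrite near_withinE => /nbhs_ballP[d /= d0 dP].
rewrite near_withinE /dnbhs near_withinE; apply/nbhs_ballP.
exists d => //= y ty yt Dy.
have := dP (y - t).
rewrite /ball /= sub0r opprB /= => /(_ _).
rewrite -[(y - t) *: 1]/(_ * _) mulr1 subrK; apply => //.
by rewrite subr_eq0.
Qed.

(** At an interior point a small enough ball lies inside the interval, so the restriction to it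
    costs nothing. This makes the mean value theorem available. *)
Lemma is_derivative_in_is_derive (a b t : R) f l : a < t < b ->
  is_derivative_in `[a, b] (f : R -> R^o) t (l : R^o) -> is_derive t 1 f l.
Proof.
move=> /andP[at_ tb] df.
have H : h^-1 *: ((f (h *: 1 + t) : R^o) - f t) @[h --> (0 : R)^'] --> (l : R^o).
  apply/cvgrPdist_le => e e0.
  have /cvgrPdist_le/(_ e e0) := df.
  rewrite near_withinE /dnbhs near_withinE => /nbhs_ballP[d /= d0 dP].
  rewrite near_withinE; apply/nbhs_ballP.
  exists (Num.min d (Num.min (t - a) (b - t))) => /=.
    by rewrite !lt_min d0 !subr_gt0 at_ tb.
  move=> h; rewrite /ball /= sub0r normrN !lt_min => /and3P[hd ha hb] h0.
  have := dP (h + t); rewrite -[h *: 1]/(_ * _) mulr1 addrK; apply => //.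
  - by rewrite /ball /= opprD addrCA subrr addr0 normrN.
  - by rewrite -subr_eq0 addrK.
  - rewrite in_itv /=; move: ha hb; rewrite !ltr_norml => /andP[h1 h2] /andP[h3 h4].
    by apply/andP; split; lra.
by apply: DeriveDef; [apply/cvg_ex; exists l|apply: cvg_lim].
Qed.

(** Only left difference quotients are used, so the minimum may sit at [T]: their numerator is
    nonnegative and their denominator negative. *)
Lemma is_derivative_in_min_le0 (T t : R) f l : 0 < t <= T ->
  (forall y, 0 <= y <= T -> f t <= f y) ->
  is_derivative_in `[0, T] (f : R -> R^o) t (l : R^o) -> l <= 0.
Proof.
move=> /andP[t0 tT] fmin df.
have H : (y - t)^-1 * (f y - f t) @[y --> t^'-] --> l.
  apply: cvg_trans df => P dP.
  have {}dP : \forall y \near t, y != t -> `[0, T]%classic y ->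
    P ((y - t)^-1 * (f y - f t)) := dP.
  suff : \forall y \near t, y < t -> P ((y - t)^-1 * (f y - f t)) by [].
  have y0P : \forall y \near t, y < t -> 0 < y by exact: nbhs_left_gt.
  apply: filterS2 dP y0P => y dP y0 yt; apply: dP; first by rewrite lt_eqF.
  by rewrite /= in_itv /= (ltW (y0 yt)) ltW // (lt_le_trans yt).
apply: (cvgr_to_le H); near=> y.
have yt : y < t by near: y; exact: nbhs_left_lt.
rewrite mulr_le0_ge0 // ?invr_le0 ?subr_le0 ?subr_ge0 ?(ltW yt) // fmin //.
apply/andP; split; last by rewrite (le_trans (ltW yt)).
by apply/ltW; near: y; exact: nbhs_left_gt.
Unshelve. all: by end_near. Qed.

(** The differential equation is imposed only for positive times. By the mean value theorem the
    quotient at 0 equals [g c] for some [c] between 0 and [y], and continuity of [g] at 0 gives the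
    limit. *)
Lemma is_derivative_in_left_endpoint (T : R) f g : 0 < T ->
  {within `[0, T], continuous f} -> {within `[0, T], continuous g} ->
  (forall t, 0 < t <= T ->
     is_derivative_in `[0, T] (f : R -> R^o) t (g t : R^o)) ->
  is_derivative_in `[0, T] (f : R -> R^o) 0 (g 0 : R^o).
Proof.
move=> T0 cf cg df; apply/cvgrPdist_le => e e0.
have /subspace_continuousP/(_ 0) := cg.
rewrite /= in_itv /= lexx (ltW T0) => /(_ isT)/cvgrPdist_le/(_ e e0).
rewrite near_withinE => /nbhs_ballP[d /= d0 dP].
rewrite near_withinE /dnbhs near_withinE; apply/nbhs_ballP.
exists d => //= y yd y0; rewrite in_itv /= => /andP[y0' yT].
have {}y0 : 0 < y by rewrite lt_neqAle eq_sym y0.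
have cfy : {within `[0, y], continuous f}.
  apply: continuous_subspaceW cf => x /=; rewrite !in_itv /=.
  by move=> /andP[-> xy]; exact: le_trans yT.
have [c] : exists2 c, c \in `]0, y[ & f y - f 0 = g c * (y - 0).
  apply: MVT => // c; rewrite in_itv /= => /andP[c0 cy].
  apply: (is_derivative_in_is_derive 0 T); first by rewrite c0 (lt_le_trans cy).
  by apply: df; rewrite c0 ltW // (lt_le_trans cy).
rewrite in_itv /= => /andP[c0 cy] ->.
rewrite -[_ *: _]/(_ * _) mulrC mulfK ?subr_eq0 ?gt_eqF //.
apply: dP; last by rewrite /= in_itv /= ltW // ltW // (lt_le_trans cy).
move: yd; rewrite /ball /= !sub0r !normrN !gtr0_norm //; exact: lt_trans.
Qed.

End relative_derivative.

(** * Maximum principle and comparison with layer functions *)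

Section layers.
Context {R : realType} {n : nat}.
Implicit Types (a : R -> 'M[R]_n.+1) (eps : 'rV[R]_n.+1).

(* At a negative global minimum, over all components and all times, [y' <= 0]
   while the row sum times the minimal value bounds [A y] from above. *)
Lemma maximum_principle (T : R) a eps (y y' : 'I_n.+1 -> R -> R) :
  0 < T -> (forall i, 0 < eps 0 i) ->
  (forall t, 0 <= t <= T -> forall i j, i != j -> a t i j <= 0) ->
  (forall t, 0 <= t <= T -> forall i, 0 < \sum_j a t i j) ->
  (forall i, {within `[0, T], continuous (y i)}) ->
  (forall i t, 0 < t <= T ->
     is_derivative_in `[0, T] (y i : R -> R^o) t (y' i t : R^o)) ->
  (forall i, 0 <= y i 0) ->
  (forall i t, 0 < t <= T ->
     0 <= eps 0 i * y' i t + \sum_j a t i j * y j t) ->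
  forall i t, 0 <= t <= T -> 0 <= y i t.
Proof.
move=> T0 eps0 aoff arow cy dy y0 Ly i t tT.
have /choice[c cP] : forall i, exists c, 0 <= c <= T /\
    forall t, 0 <= t <= T -> y i c <= y i t.
  move=> j; have [c] := EVT_min (ltW T0) (cy j).
  rewrite in_itv /= => cT cmin; by exists c.
have [i0 _ i0min] := @arg_minP _ _ _ (ord0 : 'I_n.+1) predT
  (fun i => y i (c i)) isT.
have [c0T cmin] := cP i0.
have ymin j s : 0 <= s <= T -> y i0 (c i0) <= y j s.
  by move=> sT; apply: le_trans (i0min j isT) _; exact: (cP j).2.
rewrite leNgt; apply/negP => yit.
have ylt0 : y i0 (c i0) < 0 by exact: le_lt_trans (ymin i t tT) yit.
(* The minimal value is negative while the initial values are not, so it is attained at a positive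
   time, where the equation holds. *)
have c0 : 0 < c i0 <= T.
  move: c0T => /andP[c0 ->]; rewrite andbT lt_neqAle c0 andbT.
  by apply/eqP => cE; move: ylt0; rewrite -cE ltNge y0.
have y'le0 := is_derivative_in_min_le0 T _ _ _ c0 cmin (dy i0 _ c0).
have := Ly i0 _ c0; rewrite leNgt => /negP; apply.
apply: (@le_lt_trans _ _ ((\sum_j a (c i0) i0 j) * y i0 (c i0))); last first.
  by rewrite pmulr_rlt0 // arow.
rewrite -[leRHS]add0r; apply: lerD.
  by rewrite mulr_ge0_le0 // ltW.
rewrite mulr_suml; apply: ler_sum => j _.
have [<-//|ij] := eqVneq i0 j.
by rewrite ler_wnM2l // ?aoff // ymin.
Qed.

Lemma is_derivative_in_layer (D : set R) alpha eps q t :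
  is_derivative_in D (layer alpha eps q : R -> R^o) t
    (- (alpha / eps 0 q) * layer alpha eps q t : R^o).
Proof.
apply: is_derive_is_derivative_in.
have -> : layer alpha eps q = expR \o (- (alpha / eps 0 q) \*: (id : R -> R^o)).
  apply/funext => s; rewrite /layer /= -[_ *: _]/(_ * _); congr expR.
  by rewrite mulNr mulrAC.
by apply: is_derive_eq; rewrite -[_ *: _]/(_ * _) mulr1 mulrC.
Qed.

(** The maximum principle applies to [psi + z] and [psi - z], where [psi] has coefficients [k].
    Since [eps_i B_q' = - alpha (eps_i / eps_q) B_q], the factor of [layer alpha eps q t] in the
    last hypothesis is the coefficient of that layer in the operator applied to [psi]. All layers
    equal 1 at time 0, whence the initial condition. *)
Lemma layer_comparison (T alpha : R) a eps (z z' : 'I_n.+1 -> R -> R)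
    (k : 'I_n.+1 -> 'I_n.+1 -> R) :
  0 < T -> (forall i, 0 < eps 0 i) ->
  (forall t, 0 <= t <= T -> forall i j, i != j -> a t i j <= 0) ->
  (forall t, 0 <= t <= T -> forall i, 0 < \sum_j a t i j) ->
  (forall i, {within `[0, T], continuous (z i)}) ->
  (forall i t, 0 < t <= T ->
     is_derivative_in `[0, T] (z i : R -> R^o) t (z' i t : R^o)) ->
  (forall i, `|z i 0| <= \sum_q k i q) ->
  (forall i t, 0 < t <= T ->
     `|eps 0 i * z' i t + \sum_j a t i j * z j t| <=
       \sum_q (\sum_j a t i j * k j q - alpha * (eps 0 i / eps 0 q) * k i q)
          * layer alpha eps q t) ->
  forall i t, 0 <= t <= T -> `|z i t| <= \sum_q k i q * layer alpha eps q t.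
Proof.
move=> T0 eps0 aoff arow cz dz z0 Lz i t tT.
pose B := layer alpha eps.
pose psi i t := \sum_q k i q * B q t.
pose psi' i t := \sum_q k i q * (- (alpha / eps 0 q) * B q t).
have dpsi j s : is_derivative_in `[0, T] (psi j : R -> R^o) s (psi' j s : R^o).
  apply: is_derivative_in_sum => q; apply: is_derivative_inZ.
  exact: is_derivative_in_layer.
have cpsi j : {within `[0, T], continuous (psi j)}.
  by apply: is_derivative_in_continuous => s _; exists (psi' j s).
(* A sign [s] treats the upper and the lower bound by a single use of the maximum principle. *)
suff H s : `|s| = 1 -> 0 <= psi i t + s * z i t.
  rewrite -/(psi i t) ler_norml.
  have := H 1 (normr1 _); have := H (-1) (normrN1 _).
  rewrite mul1r mulN1r => h1 h2; apply/andP; split; lra.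
move=> s1.
apply: (maximum_principle T a eps (fun i t => psi i t + s * z i t)
  (fun i t => psi' i t + s * z' i t)) => //.
- move=> j; apply/subspace_continuousP => x Dx; apply: cvgD.
    by move/subspace_continuousP : (cpsi j); exact.
  apply: cvgM; first exact: cvg_cst.
  by move/subspace_continuousP : (cz j); exact.
- move=> j x xT; apply: is_derivative_inD; first exact: dpsi.
  by apply: is_derivative_inZ; exact: dz.
- move=> j; have -> : psi j 0 = \sum_q k j q.
    by apply: eq_bigr => q _; rewrite /B /layer mulr0 mul0r oppr0 expR0 mulr1.
  have := z0 j; rewrite -[`|z j 0|]mul1r -s1 -normrM ler_norml => /andP[+ _].
  by rewrite -subr_ge0 opprK addrC.
- move=> j x xT.
  have -> : eps 0 j * (psi' j x + s * z' j x) +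
      \sum_i a x j i * (psi i x + s * z i x) =
      \sum_q (\sum_i a x j i * k i q - alpha * (eps 0 j / eps 0 q) * k j q)
          * B q x + s * (eps 0 j * z' j x + \sum_i a x j i * z i x).
    under eq_bigr do rewrite mulrDr; rewrite big_split /=.
    have -> : \sum_i a x j i * psi i x =
        \sum_q (\sum_i a x j i * k i q) * B q x.
      under eq_bigr do rewrite mulr_sumr; rewrite exchange_big /=.
      by apply: eq_bigr => q _; rewrite mulr_suml; apply: eq_bigr => i0 _; ring.
    under [in RHS]eq_bigr do rewrite mulrBl; rewrite [in RHS]big_split /=.
    have -> : \sum_q - (alpha * (eps 0 j / eps 0 q) * k j q * B q x) =
        eps 0 j * psi' j x.
      by rewrite mulr_sumr; apply: eq_bigr => q _; ring.
    have -> : \sum_i a x j i * (s * z i x) = s * \sum_i a x j i * z i x.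
      by rewrite mulr_sumr; apply: eq_bigr => i0 _; ring.
    ring.
  have := Lz j x xT; rewrite -[`|_ + _|]mul1r -s1 -normrM ler_norml.
  by move=> /andP[+ _]; rewrite -subr_ge0 opprK addrC.
Qed.

End layers.

(** * Barrier for the first derivative *)

Section derivative_bound.
Context {R : realType} {n : nat}.
Implicit Types (a : R -> 'M[R]_n.+1) (eps : 'rV[R]_n.+1).

(** Bookkeeping for one large term at index [i] set against a loss [c] charged to every index, so
    that sums can be compared term by term. *)
Lemma sum_pick_sub (F : 'I_n.+1 -> R) (c : R) i :
  \sum_q ((if q == i then F q else 0) - c) = F i - n.+1%:R * c.
Proof.
rewrite big_split /= -big_mkcond big_pred1_eq.
by rewrite sumr_const card_ord mulNrn mulr_natl.
Qed.

Lemma layer_le (alpha : R) eps (q i : 'I_n.+1) t :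
  0 < alpha -> (forall i, 0 < eps 0 i) -> eps 0 q <= eps 0 i -> 0 <= t ->
  layer alpha eps q t <= layer alpha eps i t.
Proof.
move=> alpha0 eps0 qi t0; rewrite /layer ler_expR lerN2.
by rewrite ler_wpM2l ?(mulr_ge0 (ltW alpha0)) // lef_pV2 ?posrE.
Qed.

(* The exact response of component [i] to a faster layer [q < i] has a part
   proportional to [B_q / eps_i] of negative sign; it is what absorbs the
   source [a_ij B_q / eps_q] coming from the components [j <= q].  The weights
   [c] grow fast enough for the [B_i / eps_i] term to pay for it. *)
Lemma layer_derivative_bound (T alpha de K G : R) (c d : nat -> R) a eps
    (z z' : 'I_n.+1 -> R -> R) :
  0 < T -> 0 < alpha -> 0 < de ->
  (forall i, 0 < eps 0 i) ->
  (forall i j : 'I_n.+1, (i <= j)%N -> eps 0 i <= eps 0 j) ->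
  (forall i, eps 0 i <= 1) ->
  (forall t, 0 <= t <= T -> forall i j, i != j -> a t i j <= 0) ->
  (forall t, 0 <= t <= T -> forall i, alpha + de <= \sum_j a t i j) ->
  (forall t, 0 <= t <= T -> forall i j, `|a t i j| <= K) ->
  0 <= G -> (forall i, 0 <= c i) -> (forall i, 0 <= d i) ->
  (forall i, G <= c i - n.+1%:R * d i) ->
  (forall i, n.+1%:R * (K * d i) + G <= de * c i) ->
  (forall q i, (q < i)%N -> n.+1%:R * (K * c q) <= alpha * d i) ->
  (forall i, {within `[0, T], continuous (z i)}) ->
  (forall i t, 0 < t <= T ->
     is_derivative_in `[0, T] (z i : R -> R^o) t (z' i t : R^o)) ->
  (forall i, `|z i 0| <= G / eps 0 i) ->
  (forall i t, 0 < t <= T ->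
     `|eps 0 i * z' i t + \sum_j a t i j * z j t|
       <= G * layer alpha eps ord_max t) ->
  forall i t, 0 <= t <= T ->
    `|z i t| <= \sum_(q < n.+1 | (i <= q)%N) c q * (layer alpha eps q t / eps 0 q).
Proof.
move=> T0 alpha0 de0 eps0 epsle eps1 aoff arow aK G0 c0 d0 cG cde dc cz dz z0 Lz
  i t tT.
pose B := layer alpha eps.
have B0 q s : 0 <= B q s by exact: expR_ge0.
pose k (i q : 'I_n.+1) := if (i <= q)%N then c q / eps 0 q else - (d i / eps 0 i).
have ceps0 q (j : 'I_n.+1) : 0 <= c q / eps 0 j by rewrite divr_ge0 // ltW.
have deps0 q (j : 'I_n.+1) : 0 <= d q / eps 0 j by rewrite divr_ge0 // ltW.
have K0 : 0 <= K.
  by apply: le_trans (aK 0 _ ord0 ord0); rewrite // lexx ltW.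
(* The negative coefficients matter only for the supersolution property; dropping them leaves the
   stated bound. *)
apply: (@le_trans _ _ (\sum_q k i q * B q t)); last first.
  rewrite [leRHS]big_mkcond /=; apply: ler_sum => q _; rewrite /k.
  case: ifP => _; first by rewrite mulrAC mulrA.
  by rewrite mulNr oppr_le0 mulr_ge0.
apply: (layer_comparison T alpha a eps z z' k) => //.
- by move=> s sT j; apply: lt_le_trans (arow s sT j); rewrite addr_gt0.
- move=> j; apply: le_trans (z0 j) _.
  (* At time 0 the diagonal weight pays for the negative terms, of which there are at most
     [n.+1]. *)
  apply: (@le_trans _ _ (c j / eps 0 j - n.+1%:R * (d j / eps 0 j))).
    by rewrite mulrA -mulrBl ler_wpM2r ?cG // invr_ge0 ltW.
  rewrite -(sum_pick_sub (fun q => c q / eps 0 q) _ j); apply: ler_sum => q _.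
  rewrite /k; have [->|qj] := eqVneq q j.
    by rewrite leqnn lerBlDr lerDl.
  rewrite sub0r; case: ifP => _ //.
  by apply: le_trans (ceps0 q q); rewrite oppr_le0.
- move=> {}i {}t {tT} /andP[t0 tT]; apply: le_trans (Lz i t _) _; first by rewrite t0.
  have {}tT : 0 <= t <= T by rewrite ltW.
  rewrite -/B.
  set E := fun q => \sum_j a t i j * k j q - alpha * (eps 0 i / eps 0 q) * k i q.
  (* The row sum supplies [alpha + de]; differentiating the layer costs at most [alpha] because
     [eps_i <= eps_q]. The surplus [de] remains. *)
  have Ege (q : 'I_n.+1) : (i <= q)%N -> de * (c q / eps 0 q) <= E q.
    move=> iq; have kiq : k i q = c q / eps 0 q by rewrite /k iq.
    have h1 : (alpha + de) * (c q / eps 0 q) <= \sum_j a t i j * k j q.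
      apply: (@le_trans _ _ (\sum_j a t i j * (c q / eps 0 q))).
        by rewrite -mulr_suml ler_wpM2r // arow.
      apply: ler_sum => j _; have [<-|ij] := eqVneq i j; first by rewrite kiq.
      rewrite ler_wnM2l ?aoff // /k; case: ifP => // _.
      by apply: le_trans (ceps0 q q); rewrite oppr_le0.
    have h2 : alpha * (eps 0 i / eps 0 q) * k i q <= alpha * (c q / eps 0 q).
      rewrite kiq ler_wpM2r // ger_pMr // ler_pdivrMr // mul1r.
      exact: epsle.
    by rewrite /E lerBrDr; apply: le_trans h1; rewrite mulrDl addrC lerD.
  (* Differentiating the negative part yields [alpha * d i / eps_q], which cancels the terms
     [K * c q / eps_q] of the other components. Only the diagonal loss is left. *)
  have Elt (q : 'I_n.+1) : (q < i)%N -> - (K * (d i / eps 0 i)) <= E q.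
    move=> qi; have kiq : k i q = - (d i / eps 0 i) by rewrite /k leqNgt qi.
    have h1 : - (K * (d i / eps 0 i)) - n.+1%:R * (K * (c q / eps 0 q)) <=
        \sum_j a t i j * k j q.
      rewrite -(sum_pick_sub (fun=> - (K * (d i / eps 0 i))) _ i).
      apply: ler_sum => j _; have := aK t tT i j; rewrite ler_norml => /andP[aK1 aK2].
      have Kc0 : 0 <= K * (c q / eps 0 q) by rewrite mulr_ge0.
      have [->|ij] := eqVneq j i.
        rewrite kiq mulrN; apply: (@le_trans _ _ (- (K * (d i / eps 0 i)))).
          by rewrite lerBlDr lerDl.
        by rewrite lerN2 ler_wpM2r //; apply: le_trans (ler_norm _) (aK t tT i i).
      rewrite sub0r /k; case: ifP => _.
        by rewrite -mulNr ler_wpM2r.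
      rewrite mulrN lerN2 (le_trans _ Kc0) // mulr_le0_ge0 //.
      by rewrite aoff // eq_sym.
    have h2 : n.+1%:R * (K * (c q / eps 0 q)) <=
        - (alpha * (eps 0 i / eps 0 q) * k i q).
      rewrite kiq mulrN opprK.
      have -> : alpha * (eps 0 i / eps 0 q) * (d i / eps 0 i) =
          alpha * d i / eps 0 q.
        by field; rewrite !gt_eqF.
      rewrite !mulrA ler_wpM2r ?invr_ge0 ?(ltW (eps0 _)) // -mulrA.
      exact: dc.
    rewrite /E; apply: le_trans (lerD h1 h2); lra.
  (* [X] bounds the deficit of each layer [q < i], as [B_q <= B_i]. The family [F] below charges [X]
     to every index, refunds the total at [i] and puts the source at [ord_max]; it sums to the
     source and lies below the barrier term by term. *)
  set X := K * (d i / eps 0 i) * B i t.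
  have X0 : 0 <= X by rewrite mulr_ge0 // mulr_ge0.
  have GB0 : 0 <= G * B ord_max t by rewrite mulr_ge0.
  pose F q := (if q == i then n.+1%:R * X else 0) +
    (if q == ord_max then G * B q t else 0) - X.
  have -> : G * B ord_max t = \sum_q F q.
    under eq_bigr => q _ do rewrite /F addrAC.
    rewrite big_split /= (sum_pick_sub (fun=> n.+1%:R * X)) subrr add0r.
    by rewrite -big_mkcond big_pred1_eq.
  apply: ler_sum => q _; rewrite /F.
  case: (leqP i q) => iq; last first.
    have -> : (q == i) = false by apply/eqP => qi; rewrite qi ltnn in iq.
    have -> : (q == ord_max) = false.
      by apply/eqP => qi; move: iq; rewrite qi ltnNge leq_ord.
    rewrite !add0r.
    apply: (@le_trans _ _ (- (K * (d i / eps 0 i)) * B q t)); last first.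
      by rewrite ler_wpM2r // Elt.
    rewrite mulNr lerN2 /X ler_wpM2l //; first by rewrite mulr_ge0.
    by apply: layer_le => //; [exact/epsle/ltnW|case/andP: tT].
  apply: le_trans (ler_wpM2r (B0 q t) (Ege q iq)).
  rewrite lerBlDr; apply: (@le_trans _ _ (de * (c q / eps 0 q) * B q t)); last first.
    by rewrite lerDl.
  rewrite mulrA mulrAC.
  have Y0 : 0 <= B q t / eps 0 q by rewrite divr_ge0 // ltW.
  have -> : de * c q * B q t / eps 0 q = de * c q * (B q t / eps 0 q).
    by rewrite mulrA.
  apply: (@le_trans _ _ ((n.+1%:R * (K * d q) + G) * (B q t / eps 0 q))); last first.
    by rewrite ler_wpM2r.
  rewrite mulrDl; apply: lerD.
    case: eqVneq => [->|_]; last by do 3![rewrite mulr_ge0 //].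
    by rewrite /X le_eqVlt; apply/orP; left; apply/eqP; ring.
  case: eqVneq => [_|_]; last by rewrite mulr_ge0.
  by rewrite ler_wpM2l // ler_pdivlMr // ler_piMr.
Qed.

(** With [c i = M * L ^+ i] and [d i] proportional to [c i / L], the last inequality is an equality
    for consecutive indices and extends by monotonicity. A large ratio [L] makes the terms in [d] at
    most half of those in [c], and [M] makes the other half cover [G]. *)
Lemma layer_weights (N K G alpha de : R) :
  0 <= N -> 0 <= K -> 0 <= G -> 0 < alpha -> 0 < de ->
  exists c d : nat -> R,
    [/\ (forall i, 0 <= c i) /\ (forall i, 0 <= d i),
        forall q i, (q <= i)%N -> c q <= c i,
        forall i, G <= c i - N * d i,
        forall i, N * (K * d i) + G <= de * c i &
        forall q i, (q < i)%N -> N * (K * c q) <= alpha * d i].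
Proof.
move=> N0 K0 G0 alpha0 de0.
(* Chosen so that [N * d i = p / L * c i] and [N * (K * d i) = de * (r / L * c i)]; hence the terms
   [2 * p] and [2 * r] in [L]. *)
pose p := N ^+ 2 * K / alpha; pose r := N ^+ 2 * K ^+ 2 / alpha / de.
have p0 : 0 <= p by rewrite !mulr_ge0 ?invr_ge0 ?exprn_ge0 // ltW.
have r0 : 0 <= r by rewrite !mulr_ge0 ?invr_ge0 ?exprn_ge0 // ltW.
pose L := 1 + 2 * p + 2 * r; have L1 : 1 <= L by rewrite /L; lra.
have L0 : 0 < L by lra.
pose M := 2 * G + 2 * (G / de).
have Gde0 : 0 <= G / de by rewrite divr_ge0 // ltW.
pose c i := M * L ^+ i; pose d i := N * K / alpha * c i / L.
have cM i : M <= c i by rewrite ler_peMr ?exprn_ege1 // /M; lra.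
have c0 i : 0 <= c i by apply: le_trans (cM i); rewrite /M; lra.
have cle q i : (q <= i)%N -> c q <= c i.
  by move=> qi; rewrite ler_wpM2l ?ler_weXn2l // /M; lra.
exists c, d; split => //.
- split => // i; rewrite divr_ge0 ?(ltW L0) // mulr_ge0 //.
  by rewrite divr_ge0 ?mulr_ge0 ?(ltW alpha0).
- move=> i; have -> : N * d i = p / L * c i by rewrite /d /p; field; rewrite !gt_eqF.
  have : p / L * c i <= 2^-1 * c i.
    by rewrite ler_wpM2r // ler_pdivrMr // /L; lra.
  have := cM i; rewrite /M; lra.
- move=> i.
  have -> : N * (K * d i) = de * (r / L * c i).
    by rewrite /d /r; field; rewrite !gt_eqF.
  have -> : G = de * (G / de) by rewrite mulrC divfK ?gt_eqF.
  rewrite -mulrDr ler_wpM2l //; first exact: ltW.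
  have : r / L * c i <= 2^-1 * c i.
    by rewrite ler_wpM2r // ler_pdivrMr // /L; lra.
  have := cM i; rewrite /M; lra.
- move=> q [//|i]; rewrite ltnS => qi.
  have -> : alpha * d i.+1 = N * (K * c i).
    by rewrite /d /c exprS; field; rewrite !gt_eqF.
  by rewrite ler_wpM2l // ler_wpM2l // cle.
Qed.

End derivative_bound.

(** * Continuity and uniform bounds for matrix functions *)

Section bounds.
Context {R : realType}.

Lemma continuous_entry (D : set R) m p (F : R -> 'M[R]_(m.+1, p.+1)) i j :
  {within D, continuous F} -> {within D, continuous (fun t => F t i j)}.
Proof.
move=> /subspace_continuousP cF; apply/subspace_continuousP => t Dt.
exact: (cvg_comp _ _ (cF t Dt) (@coord_continuous R _ _ i j (F t))).
Qed.

Lemma continuous_mulmx_entry (D : set R) m p (F : R -> 'M[R]_(m.+1, p.+1))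
    (G : R -> 'cV[R]_p.+1) i :
  {within D, continuous F} -> {within D, continuous G} ->
  {within D, continuous (fun t => \sum_j F t i j * G t j 0)}.
Proof.
move=> cF cG; apply/subspace_continuousP => t Dt.
apply: cvg_big => [|j _]; first exact: add_continuous.
have /subspace_continuousP/(_ t Dt) cFj := continuous_entry D _ _ F i j cF.
have /subspace_continuousP/(_ t Dt) cGj := continuous_entry D _ _ G j 0 cG.
exact: cvgM.
Qed.

Lemma continuous_mx_bounded (a b : R) m p (F : R -> 'M[R]_(m.+1, p.+1)) :
  a <= b -> {within `[a, b], continuous F} ->
  exists2 K, 0 <= K & forall t, a <= t <= b -> forall i j, `|F t i j| <= K.
Proof.
move=> ab cF.
have /choice[M MP] : forall ij : 'I_m.+1 * 'I_p.+1, exists M,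
    forall t, a <= t <= b -> `|F t ij.1 ij.2| <= M.
  move=> [i j].
  have /subspace_continuousP cFij := continuous_entry _ _ _ F i j cF.
  have cN : {within `[a, b], continuous (fun t => `|F t i j|)}.
    by apply/subspace_continuousP => t tab; apply: cvg_norm; exact: cFij.
  have [c _ cmax] := EVT_max ab cN.
  by exists `|F c i j| => t tab; apply: cmax; rewrite in_itv.
have M0 ij : 0 <= M ij.
  by apply: le_trans (MP ij a _); rewrite ?lexx.
(* The sum of the nonnegative entrywise bounds dominates each of them. *)
exists (\sum_ij M ij); first exact: sumr_ge0.
move=> t tab i j; apply: le_trans (MP (i, j) t tab) _.
by rewrite (bigD1 (i, j)) //= lerDl sumr_ge0.
Qed.

Lemma ler_norm_sum_mul p (u v : 'I_p -> R) (K X : R) :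
  0 <= K -> (forall j, `|u j| <= K) -> (forall j, `|v j| <= X) ->
  `|\sum_j u j * v j| <= p%:R * (K * X).
Proof.
move=> K0 uK vX; apply: le_trans (ler_norm_sum _ _ _) _.
rewrite mulr_natl -[in leRHS](card_ord p) -sumr_const; apply: ler_sum => j _.
by rewrite normrM ler_pM.
Qed.

End bounds.

(* The system has size n.+1, so that ord_max is the index of the largest
   parameter. *)
Theorem lemma2p4 (R : realType) (n : nat) (T alpha : R)
    (A : R -> 'M[R]_n.+1) (f : R -> 'cV[R]_n.+1) (u0 : 'cV[R]_n.+1)
    (hT : 0 < T)
    (hA : C1_on T A)
    (hf : C1_on T f)
    (hdom : forall t, 0 <= t <= T -> forall i : 'I_n.+1,
        \sum_(j < n.+1 | j != i) `|A t i j| < A t i i)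
    (hoff : forall t, 0 <= t <= T -> forall i j : 'I_n.+1,
        i != j -> A t i j <= 0)
    (halpha0 : 0 < alpha)
    (halpha : forall t, 0 <= t <= T -> forall i : 'I_n.+1,
        alpha < \sum_(j < n.+1) A t i j) :
  exists C : R,
    forall eps : 'rV[R]_n.+1,
    (forall i, 0 < eps 0 i) ->
    (forall i j : 'I_n.+1, (i < j)%N -> eps 0 i < eps 0 j) ->
    (forall i, eps 0 i <= 1) ->
    2 * (\big[Num.max/0]_(i < n.+1) eps 0 i) / alpha <= T ->
    forall u w : R -> 'cV[R]_n.+1,
    solves_ivp T eps A f u0 u ->
    singular_component T eps A f u w ->
    exists w1 w2 : R -> 'cV[R]_n.+1,
      (forall t, 0 <= t <= T -> is_derivative_in `[0, T] w t (w1 t)) /\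
      (forall t, 0 <= t <= T -> is_derivative_in `[0, T] w1 t (w2 t)) /\
      (forall t, 0 <= t <= T -> forall i : 'I_n.+1,
        [/\ `|w t i 0| <= C * layer alpha eps ord_max t,
            `|w1 t i 0| <=
              C * \sum_(q < n.+1 | (i <= q)%N) layer alpha eps q t / eps 0 q &
            `|eps 0 i * w2 t i 0| <=
              C * \sum_(q < n.+1) layer alpha eps q t / eps 0 q]).
Proof.

(* Constants fixed before the parameters *)
have [A1 [dA cA1]] := hA.
have T0 := ltW hT.
have dAij i j t : 0 <= t <= T ->
    is_derivative_in `[0, T] (fun s => A s i j : R^o) t (A1 t i j : R^o).
  by move=> tT; apply: is_derivative_in_entry; exact: dA.
have cA : {within `[0, T], continuous A}.
  by apply: is_derivative_in_continuous => t tT; exists (A1 t); exact: dA.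
have [KA KA0 AK] := continuous_mx_bounded 0 T _ _ A T0 cA.
have [KA1 KA10 A1K] := continuous_mx_bounded 0 T _ _ A1 T0 cA1.
pose K := KA + KA1; have K0 : 0 <= K by rewrite addr_ge0.
have {}AK t : 0 <= t <= T -> forall i j, `|A t i j| <= K.
  by move=> tT i j; apply: le_trans (AK t tT i j) _; rewrite lerDl.
have {}A1K t : 0 <= t <= T -> forall i j, `|A1 t i j| <= K.
  by move=> tT i j; apply: le_trans (A1K t tT i j) _; rewrite lerDr.
(* Each row sum attains its minimum on the compact interval, so the strict inequality with [alpha]
   has a uniform gap [de]. *)
have [de de0 rowde] : exists2 de, 0 < de &
    forall t, 0 <= t <= T -> forall i, alpha + de <= \sum_j A t i j.
  have /choice[c cP] : forall i, exists c, 0 <= c <= T /\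
      forall t, 0 <= t <= T -> \sum_j A c i j <= \sum_j A t i j.
    move=> i.
    have cS : {within `[0, T], continuous (fun t => \sum_j A t i j)}.
      apply: is_derivative_in_continuous => t tT; exists (\sum_j A1 t i j).
      by apply: is_derivative_in_sum => j; exact: dAij.
    have [c] := EVT_min T0 cS.
    by rewrite in_itv /= => cT cmin; exists c.
  have [i0 _ i0min] := @arg_minP _ _ _ (ord0 : 'I_n.+1) predT
    (fun i => \sum_j A (c i) i j) isT.
  exists (\sum_j A (c i0) i0 j - alpha).
    by rewrite subr_gt0; apply: halpha; exact: (cP i0).1.
  move=> t tT i; rewrite addrC subrK.
  by apply: le_trans (i0min i isT) _; exact: (cP i).2.
(* The initial value of the singular component is the same for all parameters, which makes [W] and
   all later constants uniform. *)
pose w0 := u0 - invmx (A 0) *m f 0.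
pose W := \sum_i `|w0 i 0|.
have W0 : 0 <= W by rewrite sumr_ge0.
pose N : R := n.+1%:R.
have N0 : 0 <= N by rewrite ler0n.
(* One constant serves both for the source [A1 w] in the equation for [w1] and for
   [eps_i * w1_i(0)]. *)
pose G := N * (K * W).
have G0 : 0 <= G by rewrite mulr_ge0 // mulr_ge0.
have [c [d [[c0 d0] cle cG cde dc]]] :=
  layer_weights N K G alpha de N0 K0 G0 halpha0 de0.
(* [G] accounts for [A1 w], the other term for [A w1]; [c n] is the largest weight in use. *)
pose C3 := G + N * (K * c n).
have C30 : 0 <= C3 by rewrite addr_ge0 // mulr_ge0 // mulr_ge0.
exists (W + c n + C3) => eps eps0 epslt eps1 _ u w [_ u00 _].
case=> v [_ v0 _] [cw w00 dw].

(* Two derivatives of the singular component *)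
have epsle (i j : 'I_n.+1) : (i <= j)%N -> eps 0 i <= eps 0 j.
  rewrite leq_eqVlt => /orP[/eqP/val_inj ->//|ij].
  exact/ltW/epslt.
have {u00 v0}w00 : w 0 = w0 by rewrite w00 u00 v0.
(* The equation solved for the derivative also makes sense at time 0, and its right-hand side can be
   differentiated once more, which gives [w2]. *)
pose w1 t : 'cV[R]_n.+1 := \col_i (- (eps 0 i)^-1 * \sum_j A t i j * w t j 0).
pose w2 t : 'cV[R]_n.+1 := \col_i (- (eps 0 i)^-1 *
  \sum_j (A1 t i j * w t j 0 + A t i j * w1 t j 0)).
have cwi i : {within `[0, T], continuous (fun t => w t i 0)}.
  exact: continuous_entry.
have w1E i t : eps 0 i * w1 t i 0 + \sum_j A t i j * w t j 0 = 0.
  by rewrite mxE mulrA mulrN mulfV ?gt_eqF // mulN1r addNr.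
have w2E i t : eps 0 i * w2 t i 0 + \sum_j A t i j * w1 t j 0 =
    - \sum_j A1 t i j * w t j 0.
  rewrite mxE mulrA mulrN mulfV ?gt_eqF // mulN1r big_split /= opprD.
  by rewrite addrNK.
have dw_pos i t : 0 < t <= T ->
    is_derivative_in `[0, T] (fun s => w s i 0 : R^o) t (w1 t i 0 : R^o).
  move=> tT; have [y1 dy1 yE] := dw t tT.
  have -> : w1 t i 0 = y1 i 0.
    have := congr1 (fun M : 'cV[R]_n.+1 => M i 0) yE.
    rewrite mul_diag_mx !mxE => yiE.
    apply: (mulfI (lt0r_neq0 (eps0 i))); apply: (addIr (\sum_j A t i j * w t j 0)).
    by rewrite /= yiE -[RHS](w1E i t) mxE.
  exact: is_derivative_in_entry.
have cw1 i : {within `[0, T], continuous (fun t => w1 t i 0)}.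
  have -> : (fun t => w1 t i 0) =
      (fun t => - (eps 0 i)^-1 * \sum_j A t i j * w t j 0).
    by apply/funext => t; rewrite mxE.
  have /subspace_continuousP cS := continuous_mulmx_entry _ _ _ A w i cA cw.
  apply/subspace_continuousP => t tT.
  by apply: cvgM; [exact: cvg_cst|exact: cS].
have dwi i t : 0 <= t <= T ->
    is_derivative_in `[0, T] (fun s => w s i 0 : R^o) t (w1 t i 0 : R^o).
  move=> /andP[t0 tT]; have [<-|t0'] := eqVneq 0 t.
    apply: (is_derivative_in_left_endpoint T _ (fun t => w1 t i 0)) => //.
    by move=> s; exact: dw_pos.
  by apply: dw_pos; rewrite lt_neqAle t0' t0.
have dw1 i t : 0 <= t <= T ->
    is_derivative_in `[0, T] (fun s => w1 s i 0 : R^o) t (w2 t i 0 : R^o).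
  move=> tT.
  have -> : (fun t => w1 t i 0) =
      (fun t => - (eps 0 i)^-1 * \sum_j A t i j * w t j 0).
    by apply/funext => s; rewrite mxE.
  rewrite mxE; apply: is_derivative_inZ; apply: is_derivative_in_sum => j.
  by apply: is_derivative_inM; [exact: dAij|exact: dwi].

(* Estimates for [w], [w1] and [w2] *)
pose B := layer alpha eps.
have B0 q s : 0 <= B q s by exact: expR_ge0.
have rowpos t : 0 <= t <= T -> forall i, 0 < \sum_j A t i j.
  by move=> tT i; apply: lt_trans (halpha t tT i).
(* The barrier is the slowest layer times [W] in every component; it is a supersolution because
   [alpha * eps_j / eps_n <= alpha] is below the row sum. *)
pose k (i q : 'I_n.+1) := if q == ord_max then W else 0.
have sumk i t : \sum_q k i q * B q t = W * B ord_max t.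
  under eq_bigr do rewrite /k (fun_if ( *%R^~ _)) mul0r.
  by rewrite -big_mkcond big_pred1_eq.
have est1 i t : 0 <= t <= T -> `|w t i 0| <= W * B ord_max t.
  move=> tT; rewrite -(sumk i).
  apply: (layer_comparison T alpha A eps (fun j t => w t j 0)
    (fun j t => w1 t j 0) k) => //.
    move=> j; rewrite -big_mkcond big_pred1_eq w00.
    by rewrite /W (bigD1 j) //= lerDl sumr_ge0.
  move=> j s /andP[s0 sT]; rewrite w1E normr0; apply: sumr_ge0 => q _.
  rewrite mulr_ge0 // /k -mulr_suml -mulrBl; case: eqVneq => [->|_]; last first.
    by rewrite mulr0.
  rewrite mulr_ge0 // subr_ge0.
  apply: le_trans (ltW (halpha s _ j)); last by rewrite ltW.
  by rewrite ger_pMr // ler_pdivrMr // mul1r epsle // leq_ord.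
have est2 i t : 0 <= t <= T ->
    `|w1 t i 0| <= \sum_(q < n.+1 | (i <= q)%N) c q * (B q t / eps 0 q).
  apply: (layer_derivative_bound T alpha de K G c d A eps
    (fun j t => w1 t j 0) (fun j t => w2 t j 0)) => //.
  - by move=> j s /andP[s0 sT]; apply: dw1; rewrite ltW.
  - move=> j; rewrite mxE normrM normrN normfV (gtr0_norm (eps0 j)) [leLHS]mulrC.
    rewrite ler_wpM2r ?invr_ge0 ?(ltW (eps0 _)) //.
    apply: ler_norm_sum_mul => // q; first by apply: AK; rewrite lexx.
    have := est1 q 0; rewrite /B /layer mulr0 mul0r oppr0 expR0 mulr1; apply.
    by rewrite lexx.
  - move=> j s /andP[s0 sT]; have {}sT : 0 <= s <= T by rewrite ltW.
    rewrite w2E normrN /G -!mulrA; apply: ler_norm_sum_mul => // q.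
      exact: A1K.
    exact: est1.
have cB0 q t : 0 <= B q t / eps 0 q by rewrite divr_ge0 // ltW.
exists w1, w2; split; [|split].
- move=> t tT; apply: is_derivative_in_mx => i j; rewrite (ord1 j).
  exact: dwi.
- move=> t tT; apply: is_derivative_in_mx => i j; rewrite (ord1 j).
  exact: dw1.
move=> t tT i.
(* All weights are replaced by [c n]. The index set stays free: the tail from [i] serves for [w1],
   all indices serve for [w2]. *)
have est2' (j : 'I_n.+1) (P : pred 'I_n.+1) : (forall q : 'I_n.+1, (j <= q)%N -> P q) ->
    `|w1 t j 0| <= c n * \sum_(q | P q) B q t / eps 0 q.
  move=> jP; apply: le_trans (est2 j t tT) _.
  rewrite mulr_sumr big_mkcond [leRHS]big_mkcond /=.
  apply: ler_sum => q _; case: ifP => [/jP ->|_].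
    by rewrite ler_wpM2r // cle // leq_ord.
  by case: ifP => // _; rewrite mulr_ge0.
split.
- apply: le_trans (est1 i t tT) _; rewrite ler_wpM2r //.
  by rewrite -addrA lerDl addr_ge0.
- apply: le_trans (est2' i _ (fun q iq => iq)) _.
  rewrite ler_wpM2r ?sumr_ge0 //.
  by rewrite addrAC lerDr addr_ge0.
set S := \sum_(q < n.+1) _.
(* Since [eps_n <= 1], dividing by it only increases the layer; this absorbs the contribution of
   [A1 w]. *)
have BS : B ord_max t <= S.
  rewrite /S (bigD1 ord_max) //=; apply: (@le_trans _ _ (B ord_max t / eps 0 ord_max)).
    by rewrite ler_pdivlMr // ler_piMr.
  by rewrite lerDl sumr_ge0.
have S0 : 0 <= S by exact: le_trans BS.
apply: (@le_trans _ _ (C3 * S)); last first.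
  by rewrite ler_wpM2r // lerDr addr_ge0.
rewrite mxE mulrA mulrN mulfV ?gt_eqF // mulN1r normrN big_split /=.
apply: le_trans (ler_normD _ _) _; rewrite /C3 mulrDl; apply: lerD.
  rewrite /G -!mulrA; apply: ler_norm_sum_mul => // q; first exact: A1K.
  by apply: le_trans (est1 q t tT) _; rewrite ler_wpM2l.
rewrite -!mulrA; apply: ler_norm_sum_mul => // q; first exact: AK.
exact: est2'.
Qed.
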